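(* Fix constants $\alpha,\beta>0$ and $s\in[0,1]$. Let $(G_1,G_2)\sim\mathrm{CSBM}\left(n,\frac{\alpha\log n}{n},\frac{\beta\log n}{n},s\right)$, with latent permutation $\pi_*$. Let $M_*$ be the set of vertices of the $13$-core of the graph $G_1\wedge_{\pi_*}G_2$. Let $(\widehat M,\widehat\mu)$ be a maximal $13$-core matching of $(G_1,G_2)$. Then $$\mathbb{P}\left((\widehat M,\widehat\mu)=(M_*,\pi_*\{M_*\})\right)=1-o(1)\qquad\text{as } n\to\infty,$$ where $\pi_*\{M_*\}$ denotes the restriction of $\pi_*$ to $M_*$.
   Context: $\mathrm{SBM}(n,p,q)$: a random graph on $[n]=\{1,\dots,n\}$. Each vertex $i$ has a label $\sigma_*(i)\in\{+1,-1\}$, i.i.d. uniform. Given the labels, edges are present independently, $\{i,j\}$ with probability $p$ if $\sigma_*(i)=\sigma_*(j)$ and $q$ otherwise. $\mathrm{CSBM}(n,p,q,s)$: generate a parent graph $G\sim\mathrm{SBM}(n,p,q)$. Given $G$, let $G_1$ and $G_2'$ be two independent random subgraphs on $[n]$, each keeping every edge of $G$ independently with probability $s$. Let $\pi_*$ be a uniformly random permutation of $[n]$ independent of everything else; $G_2$ is obtained from $G_2'$ by relabeling each vertex $i$ as $\pi_*(i)$. Here $n$ is taken large enough that the edge probabilities are at most $1$; $\log$ is natural. Let $A,B$ be the adjacency matrices of $G_1,G_2$. A matching between $G_1$ and $G_2$ is a pair $(M,\mu)$ with $M\subseteq[n]$ and $\mu:M\to[n]$ injective. The intersection graph $G_1\wedge_\mu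 G_2$ has vertex set $M$ and edge set $\{\{i,j\}:i,j\in M,\ A_{ij}=B_{\mu(i)\mu(j)}=1\}$; for a permutation $\pi$ of $[n]$, $G_1\wedge_\pi G_2$ is defined via the matching $([n],\pi)$. A matching $(M,\mu)$ is a $k$-core matching if every vertex of $G_1\wedge_\mu G_2$ has degree at least $k$ in it; a maximal $k$-core matching is a $k$-core matching with the largest $|M|$ among all $k$-core matchings (the paper's Algorithm 1 outputs such a matching, found by exhaustive search). The $k$-core of a graph is its largest induced subgraph in which every vertex has degree at least $k$. *)

(* Defs.v *)
(* MathComp / MathComp-Analysis. *)
From HB Require Import structures.
From mathcomp Require Import all_boot all_order all_algebra all_fingroup.
From mathcomp Require Import all_classical all_reals all_analysis.
Set Implicit Arguments.
Unset Strict Implicit.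
Unset Printing Implicit Defensive.
Import Order.TTheory GRing.Theory Num.Theory.
Import numFieldNormedType.Exports.
Local Open Scope ring_scope.

(* The vertex set [n] is 'I_n; a simple graph on it is given by its edges, an
   arbitrary set of two-element subsets of 'I_n. *)
Definition edge (n : nat) := {e : {set 'I_n} | #|e| == 2}.
Definition graph (n : nat) := {set edge n}.

Definition adj (n : nat) (G : graph n) : rel 'I_n :=
  fun i j => [exists e in G, val e == [set i; j]%SET].

Definition relabel (n : nat) (pi : 'S_n) (G : graph n) : graph n :=
  [set e : edge n | [exists e' in G, val e == [set pi i | i in val e']%SET]]%SET.

(* A matching (M, mu) is the partial function equal to Some (mu i) on M and to
   None off M, so Leibniz equality is equality of the pairs (M, mu). *)
Definition pfun (n : nat) := {ffun 'I_n -> option 'I_n}.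

Definition pdom (n : nat) (mu : pfun n) : {set 'I_n} :=
  [set i | mu i != None]%SET.

Definition is_matching (n : nat) (mu : pfun n) : Prop :=
  {in pdom mu &, injective mu}.

Definition perm_restrict (n : nat) (pi : 'S_n) (S : {set 'I_n}) : pfun n :=
  [ffun i => if i \in S then Some (pi i) else None].

(* Edge relation of the intersection graph, whose vertex set is pdom mu. *)
Definition inter_graph (n : nat) (G1 G2 : graph n) (mu : pfun n) : rel 'I_n :=
  fun i j => match mu i, mu j with
             | Some i', Some j' => adj G1 i j && adj G2 i' j'
             | _, _ => false
             end.

Definition inter_graph_perm (n : nat) (G1 G2 : graph n) (pi : 'S_n) :
  rel 'I_n := inter_graph G1 G2 (perm_restrict pi [set: 'I_n]%SET).

(* Every vertex of the subgraph of e induced on S has degree at least k. *)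
Definition min_degree_geq (n k : nat) (e : rel 'I_n) (S : {set 'I_n}) : bool :=
  [forall i in S, (k <= #|[set j in S | e i j]%SET|)%N].

(* The largest such S is unique, since these sets are closed under union. *)
Definition core_vertices (n k : nat) (e : rel 'I_n) : {set 'I_n} :=
  [arg max_(S > finset.set0 | min_degree_geq k e S) #|S|]%N.

Definition core_matching (n k : nat) (G1 G2 : graph n) (mu : pfun n) : Prop :=
  is_matching mu /\ min_degree_geq k (inter_graph G1 G2 mu) (pdom mu).

Definition maximal_core_matching (n k : nat) (G1 G2 : graph n) (mu : pfun n) :
  Prop :=
  core_matching k G1 G2 mu /\
  forall nu : pfun n, core_matching k G1 G2 nu -> (#|pdom nu| <= #|pdom mu|)%N.

(* Community labels: true and false stand for +1 and -1. *)
Definition labels (n : nat) := {ffun 'I_n -> bool}.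

Definition same_label (n : nat) (sigma : labels n) (e : edge n) : bool :=
  [forall i in val e, forall j in val e, sigma i == sigma j].

(* Joint probability mass of the labels and the graph of SBM(n, p, q). *)
Definition sbm_mass (R : realType) (n : nat) (p q : R) (sigma : labels n)
    (G : graph n) : R :=
  2^-1 ^+ n *
  \prod_(e : edge n)
     (let r := if same_label sigma e then p else q in
      if e \in G then r else 1 - r).

(* Conditional probability mass, given G, of the random subgraph H of G. *)
Definition subsample_mass (R : realType) (n : nat) (s : R) (G H : graph n) : R :=
  \prod_(e : edge n)
     (if e \in G then (if e \in H then s else 1 - s)
      else (if e \in H then 0 else 1)).

(* Outcomes (labels, G, G_1, G_2', latent permutation) of the CSBM experiment. *)
Definition outcome (n : nat) : finType :=
  (labels n * graph n * graph n * graph n * 'S_n)%type.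

Definition obs1 (n : nat) (w : outcome n) : graph n :=
  let: (_, _, G1, _, _) := w in G1.
Definition latent_perm (n : nat) (w : outcome n) : 'S_n :=
  let: (_, _, _, _, pi) := w in pi.
Definition obs2 (n : nat) (w : outcome n) : graph n :=
  let: (_, _, _, G2', pi) := w in relabel pi G2'.

(* A genuine probability mass function as soon as p, q, s lie in [0, 1]. *)
Definition csbm_mass (R : realType) (n : nat) (p q s : R) (w : outcome n) : R :=
  let: (sigma, G, G1, G2', _) := w in
  sbm_mass p q sigma G * subsample_mass s G G1 * subsample_mass s G G2' *
  (n`!%:R)^-1.

Definition csbm_prob (R : realType) (n : nat) (p q s : R)
    (E : pred (outcome n)) : R :=
  \sum_(w : outcome n | E w) csbm_mass p q s w.

Definition true_core (n k : nat) (w : outcome n) : {set 'I_n} :=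
  core_vertices k (inter_graph_perm (obs1 w) (obs2 w) (latent_perm w)).

(* Main.v *)
Require Import Defs.
From HB Require Import structures.
From mathcomp Require Import all_boot all_order all_algebra all_fingroup.
From mathcomp Require Import all_classical all_reals all_analysis.
From mathcomp Require Import fintype finset ring lra.
Set Implicit Arguments.
Unset Strict Implicit.
Unset Printing Implicit Defensive.
Import Order.TTheory GRing.Theory Num.Theory.
Import numFieldNormedType.Exports.

(** Why the theorem holds. Write a maximal 13-core matching as a map [nu] on
    vertices, [nu = pi^-1 o mu] on its domain and the identity elsewhere
    ([displacement]). If [nu] is the identity, the matching is a restriction of
    the latent permutation, and comparing sizes with the 13-core forces it to be
    the true one ([maximal_core_matching_eq]). Otherwise each of the [d > 0]
    vertices moved by [nu] has degree at least 13, so at least [13 d / 2] edges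
    [e] of the parent graph touch a moved vertex and have an image [nu(e)] that
    is again an edge of the parent graph ([G_1] and [G_2'] matter only through
    their inclusion in it).

    These events are not independent, since [e] and [e' = nu(e)] share the edge
    [e']. But [nu] is injective on the matched vertices, so each edge conflicts
    with at most two others, and a third of the family is conflict free ([dissociated_subset]). On such a
    family [S], the edges and their images are as many as independence would
    ask for ([card_dissociatedU]), and with [r] the larger edge probability the
    event has probability at most the product over [e] in [S] of [r ^ 2], or of
    [r] when [nu(e) = e] ([sbm_contains_le]).

    It remains to sum over all [nu] and [S]. Since [6 |S| >= 13 d], a Chernoff
    weight [u ^ (6 |S| - 13 d)] may be inserted for any [u >= 1]. The sum over
    [S] is then a product over the at most [d n] pairs that touch a moved vertex,
    of which at most [d] are fixed by [nu], and is bounded by [x ^ d] with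
    [x = (1 + u^6 r) (1 + u^6 r^2)^n / u^13] ([sum_witness_le]). The sum of
    [x ^ d] over all maps [nu] factors over vertices and is at most
    [exp (n^2 x)], the identity contributing 1 ([sum_moved_neq0_le]).

    With [r] of order [log n / n] the first two factors of [x] stay bounded as
    long as [u = n ^ c] with [6 c < 1], while [n^2 x] tends to 0 as soon as
    [13 c > 2]. Such a [c] exists because [13 / 6 > 2], which is where the value
    13 comes from; the proof takes [c = 4 / 25] ([vertex_weight_le]). *)

Local Open Scope set_scope.
Local Open Scope nat_scope.

(** * Conflict-free families of arcs *)

(** In the digraph with arcs [e -> phi e], [e] in [F], every vertex has in- and
    out-degree at most 1, so choosing [e] greedily rules out only [phi e] and
    the possible preimage of [e]. The factor 3 is forced by 3-cycles. *)
Lemma dissociated_subset (T : finType) (phi : T -> T) (F : {set T}) :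
  {in F &, injective phi} ->
  exists S : {set T}, [/\ S \subset F, #|F| <= 3 * #|S|
    & {in S &, forall e e', e != e' -> phi e != e'}].
Proof.
have [m] := ubnP #|F|; elim: m F => // m IHm F; rewrite ltnS => leFm injF.
have [->|[e eF]] := set_0Vmem F.
  by exists set0; split; rewrite ?sub0set ?cards0 // => x y; rewrite inE.
(* N consists of e and of everything that conflicts with it. *)
pose N : {set T} := e |: (phi e |: [set x in F | phi x == e]).
have eN : e \in N by rewrite !inE eqxx.
have cardN : #|N| <= 3.
  rewrite (leq_trans (leq_card_setU _ _)) // cards1 ltnS.
  rewrite (leq_trans (leq_card_setU _ _)) // cards1 ltnS.
  apply/card_le1_eqP => x y; rewrite !inE => /andP[xF /eqP phix].
  by move=> /andP[yF /eqP phiy]; apply: injF => //; rewrite phix phiy.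
have ltF : #|F :\: N| < #|F|.
  apply: proper_card; rewrite properEneq subsetDl andbT.
  by apply/eqP => /setP/(_ e); rewrite inE eN eF.
have [x y|S [subS leS disS]] := IHm (F :\: N) (leq_trans ltF leFm).
  by move=> /setDP[xF _] /setDP[yF _]; apply: injF.
have notN x : x \in S -> [/\ x \in F, x != e, x != phi e & phi x != e].
  move/(subsetP subS); rewrite !inE !negb_or negb_and => /andP[/and3P[-> ->]].
  by case: (x \in F).
exists (e |: S); split.
- by rewrite subUset sub1set eF (subset_trans subS) // subsetDl.
- have eS : e \notin S by apply/negP => /notN[_]; rewrite eqxx.
  rewrite cardsU1 eS mulnDr muln1 -(cardsID N F).
  by rewrite leq_add // (leq_trans _ cardN) // subset_leq_card // subsetIr.
- move=> x y /setU1P[->|xS] /setU1P[->|yS]; rewrite ?eqxx // => xy.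
  + by have [_ _] := notN _ yS; rewrite eq_sym.
  + by have [] := notN _ xS.
  + exact: disS.
Qed.

(** The pairs [{e, phi e}] are disjoint for distinct [e] in [S]: two arcs can
    only meet head to tail, which is excluded. *)
Lemma card_dissociatedU (T : finType) (phi : T -> T) (S : {set T}) :
  {in S &, injective phi} ->
  {in S &, forall e e', e != e' -> phi e != e'} ->
  #|S :|: phi @: S| = \sum_(e in S) #|[set e; phi e]|.
Proof.
move=> injS disS.
have -> : S :|: phi @: S = S :|: phi @: [set e in S | phi e != e].
  apply/setP => x; rewrite !in_setU; case: (boolP (x \in S)) => //= xS.
  apply/imsetP/imsetP => -[e eS xE]; exists e => //; last first.
    by move: eS; rewrite inE => /andP[].
  by rewrite inE eS -xE; apply: contraNneq xS => ->.
rewrite cardsU disjoint_setI0 ?cards0 ?subn0; last first.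
  apply/pred0P => x /=; apply: contraTF isT => /andP[xS /imsetP[e]].
  rewrite inE => /andP[eS nfix] xE; have := disS e x eS xS.
  by rewrite xE eq_sym nfix eqxx => /(_ isT).
rewrite card_in_imset; last first.
  by move=> x y; rewrite !inE => /andP[xS _] /andP[yS _]; apply: injS.
rewrite -!sum1_card.
rewrite [X in _ + X](eq_bigl (fun e => (e \in S) && (phi e != e))); last first.
  by move=> e; rewrite inE.
rewrite big_mkcondr -big_split /=; apply: eq_bigr => e _.
by rewrite cards2 eq_sym; case: (_ != _).
Qed.

(** * From a wrong core matching to a family of displaced edges *)

(** Vertex pairs rather than elements of [edge n]: an arbitrary vertex map acts
    on sets of vertices, and a collapsed image is simply not in [edge_sets]. *)
Definition edge_sets (n : nat) (G : graph n) : {set {set 'I_n}} := val @: G.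

Definition moved (T : finType) (nu : T -> T) : {set T} := [set i | nu i != i].

Definition touching (T : finType) (D : {set T}) : {set {set T}} :=
  [set e : {set T} | (#|e| == 2) && (e :&: D != set0)].

(** What the union bound ranges over. Conflict-freeness enters only through the
    last clause, the form in which it is used: the number of edges whose presence
    is required splits as a sum over [S]. *)
Definition witness (T : finType) (k : nat) (nu : T -> T)
    (S : {set {set T}}) : bool :=
  let phi (e : {set T}) := nu @: e in
  [&& S \subset touching (moved nu), k * #|moved nu| <= 6 * #|S|
    & #|S :|: phi @: S| == \sum_(e in S) #|[set e; phi e]|].

Lemma card_edge_sets n (G : graph n) e : e \in edge_sets G -> #|e| = 2.
Proof. by case/imsetP => x _ ->; apply/eqP/(valP x). Qed.

Lemma edge_setsS n (G H : graph n) :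
  H \subset G -> edge_sets H \subset edge_sets G.
Proof. exact: imsetS. Qed.

Lemma adjE n (G : graph n) i j : adj G i j = ([set i; j] \in edge_sets G).
Proof.
apply/exists_inP/imsetP => -[e eG]; first by move/eqP <-; exists e.
by move=> ->; exists e.
Qed.

Lemma adj_relabel n (G : graph n) (pi : 'S_n) i j :
  adj (relabel pi G) (pi i) (pi j) = adj G i j.
Proof.
rewrite !adjE; apply/imsetP/imsetP => -[e].
  rewrite inE => /exists_inP[e' e'G /eqP ->] ije; exists e' => //.
  apply: (imset_inj (@perm_inj _ pi)).
  by rewrite -[RHS]ije imsetU1 imset_set1.
move=> eG ije.
have card2 : #|pi @: val e| == 2.
  by rewrite card_imset; [exact: (valP e) | exact: perm_inj].
exists (Sub (pi @: val e) card2 : edge n); last first.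
  by rewrite /= -ije imsetU1 imset_set1.
by rewrite inE; apply/exists_inP; exists e.
Qed.

Lemma imset_in_inj (T U : finType) (f : T -> U) (M A B : {set T}) :
  {in M &, injective f} -> A \subset M -> B \subset M ->
  f @: A = f @: B -> A = B.
Proof.
move=> injf AM BM fAB.
have sub (C D : {set T}) : C \subset M -> D \subset M ->
    f @: C = f @: D -> C \subset D.
  move=> CM DM fCD; apply/subsetP => x xC.
  have : f x \in f @: D by rewrite -fCD imset_f.
  case/imsetP => y yD /(injf _ _ (subsetP CM _ xC) (subsetP DM _ yD)).
  by move=> ->.
by apply/eqP; rewrite eqEsubset; apply/andP; split; apply: sub.
Qed.

(** Double counting: a moved vertex lies on at least [k] edges of [F] and an edge
    has two endpoints, so [2 |F| >= k |D|]; a conflict-free third of [F] then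
    satisfies [6 |S| >= k |D|]. *)
Lemma exists_witness (T : finType) (k : nat) (nu : T -> T) (M : {set T})
    (E : {set {set T}}) :
  {in M &, injective nu} -> moved nu \subset M ->
  {in E, forall e : {set T}, #|e| = 2} ->
  {in moved nu, forall i,
     k <= #|[set j in M | ([set i; j] \in E) && (nu @: [set i; j] \in E)]|} ->
  exists2 S : {set {set T}}, witness k nu S
    & S :|: (fun e : {set T} => nu @: e) @: S \subset E.
Proof.
move=> injnu subM E2 degk; set D := moved nu in subM degk *.
pose phi (e : {set T}) := nu @: e.
pose F := [set e in E | [&& e \subset M, phi e \in E & e :&: D != set0]].
have injF : {in F &, injective phi}.
  move=> e e'; rewrite !inE => /andP[_ /andP[eM _]] /andP[_ /andP[eM' _]].
  exact: (imset_in_inj injnu).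
have [S [subS leF disS]] := dissociated_subset injF.
exists S; last first.
  apply/subsetP => x /setUP[/(subsetP subS)|/imsetP[e /(subsetP subS)]].
    by rewrite inE => /andP[].
  by rewrite inE => /and4P[_ _ eE _] ->.
have countF : k * #|D| <= 2 * #|F|.
  have -> : 2 * #|F| = \sum_(e in F) \sum_(i in e) 1.
    rewrite mulnC -sum_nat_const; apply: eq_bigr => e.
    by rewrite inE => /andP[/E2 <- _]; rewrite sum1_card.
  rewrite (exchange_big_dep predT) //= mulnC -sum_nat_const.
  rewrite [leqRHS](bigID (mem D)) /=.
  apply: leq_trans (leq_addr _ _); apply: leq_sum => i iD.
  rewrite sum1_card; apply: leq_trans (degk i iD) _.
  rewrite -[leqLHS](card_in_imset (f := fun j => [set i; j])); last first.
    move=> j j'; rewrite !inE => /and3P[_ /E2 + _] /and3P[_ /E2 + _].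
    rewrite !cards2; case: eqVneq => // ij _; case: eqVneq => // ij' _.
    move=> /setP/(_ j); rewrite !inE eqxx orbT eq_sym (negPf ij) /=.
    by move/esym/eqP.
  apply/subset_leq_card/subsetP => e /imsetP[j].
  rewrite !inE => /and3P[jM eE eE'] ->; rewrite unfold_in /= !inE.
  rewrite eE eE' eqxx /=.
  rewrite !andbT subUset !sub1set jM (subsetP subM) //=.
  by apply/set0Pn; exists i; rewrite in_setI set21.
apply/and3P; split.
- apply: subset_trans subS _; apply/subsetP => e; rewrite !inE.
  by case/and4P => /E2 -> _ _ ->.
- apply: leq_trans countF _; by rewrite -[6]/(2 * 3) -mulnA leq_mul2l.
- rewrite card_dissociatedU // => x y /(subsetP subS) xF /(subsetP subS) yF.
  exact: injF.
Qed.

Section Core.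
Variables (n k : nat) (e : rel 'I_n).

Lemma min_degree_geqU (S T : {set 'I_n}) :
  min_degree_geq k e S -> min_degree_geq k e T -> min_degree_geq k e (S :|: T).
Proof.
move=> /forall_inP degS /forall_inP degT; apply/forall_inP => i /setUP[iS|iT].
  apply: leq_trans (degS i iS) (subset_leq_card _).
  by apply/subsetP => j; rewrite !inE => /andP[-> ->].
apply: leq_trans (degT i iT) (subset_leq_card _).
by apply/subsetP => j; rewrite !inE => /andP[-> ->]; rewrite orbT.
Qed.

(** As sets of minimum degree [k] are stable under union, one of largest size
    contains all the others. *)
Lemma core_verticesP :
  min_degree_geq k e (core_vertices k e) /\
  forall S, min_degree_geq k e S -> S \subset core_vertices k e.
Proof.
rewrite /core_vertices; case: arg_maxnP => [|C degC maxC].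
  by apply/forall_inP => i; rewrite inE.
split=> // S degS; apply/setUidPr/eqP; rewrite eq_sym eqEcard subsetUr /=.
exact/maxC/min_degree_geqU.
Qed.

End Core.

Lemma pdom_perm_restrict n (pi : 'S_n) (S : {set 'I_n}) :
  pdom (perm_restrict pi S) = S.
Proof. by apply/setP => i; rewrite !inE ffunE; case: (i \in S). Qed.

Lemma inter_graph_permE n (G1 G2 : graph n) (pi : 'S_n) i j :
  inter_graph_perm G1 G2 pi i j = adj G1 i j && adj G2 (pi i) (pi j).
Proof. by rewrite /inter_graph_perm /inter_graph !ffunE !inE. Qed.

Lemma min_degree_geq_in n k (e e' : rel 'I_n) (S : {set 'I_n}) :
  {in S &, e =2 e'} -> min_degree_geq k e S = min_degree_geq k e' S.
Proof.
move=> ee'; apply: eq_forallb_in => i iS; congr (k <= _); apply: eq_card => j.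
by rewrite !inE; case: (boolP (j \in S)) => //= jS; rewrite ee'.
Qed.

Lemma core_matching_perm_restrict n k (G1 G2 : graph n) (pi : 'S_n) S :
  core_matching k G1 G2 (perm_restrict pi S) <->
  min_degree_geq k (inter_graph_perm G1 G2 pi) S.
Proof.
rewrite /core_matching pdom_perm_restrict.
rewrite (@min_degree_geq_in _ _ _ (inter_graph_perm G1 G2 pi)); last first.
  move=> i j iS jS; rewrite inter_graph_permE /inter_graph !ffunE.
  by rewrite iS jS.
split=> [[]//|degS]; split=> // i j; rewrite pdom_perm_restrict => iS jS.
by rewrite !ffunE iS jS => -[/perm_inj].
Qed.

(** The matching seen through the latent permutation, extended by the identity to
    a total map; the matching is a restriction of [pi] when this is [id]. It may
    fail to be injective outside the domain of [mu], so the union bound is over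
    all vertex maps. *)
Definition displacement n (mu : pfun n) (pi : 'S_n) : {ffun 'I_n -> 'I_n} :=
  [ffun i => if mu i is Some i' then pi^-1%g i' else i].

(** The domain of such a [mu] is contained in the core, and it is at least as
    large as the core because the core is itself matched by [pi]. *)
Lemma maximal_core_matching_eq n k (G1 G2 : graph n) (mu : pfun n)
    (pi : 'S_n) :
  maximal_core_matching k G1 G2 mu -> displacement mu pi =1 id ->
  mu = perm_restrict pi (core_vertices k (inter_graph_perm G1 G2 pi)).
Proof.
move=> [coremu maxmu] mu_id; set C := core_vertices _ _.
have [degC maxC] := core_verticesP k (inter_graph_perm G1 G2 pi).
have mupi : mu = perm_restrict pi (pdom mu).
  apply/ffunP => i; rewrite ffunE inE; move: (mu_id i); rewrite ffunE.
  by case: (mu i) => //= i' <-; rewrite permKV.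
have degmu : min_degree_geq k (inter_graph_perm G1 G2 pi) (pdom mu).
  by apply/core_matching_perm_restrict; rewrite -mupi.
have := maxmu _ (proj2 (core_matching_perm_restrict k G1 G2 pi C) degC).
rewrite pdom_perm_restrict => leC; rewrite mupi; congr perm_restrict.
by apply/eqP; rewrite eqEcard leC maxC.
Qed.

Lemma core_matching_witness n k (G G1 G2 : graph n) (mu : pfun n) (pi : 'S_n) :
  G1 \subset G -> G2 \subset G -> core_matching k G1 (relabel pi G2) mu ->
  exists2 S : {set {set 'I_n}}, witness k (displacement mu pi) S
    & S :|: (fun e : {set 'I_n} => displacement mu pi @: e) @: S
        \subset edge_sets G.
Proof.
move=> sub1 sub2 [injmu degmu]; set nu := displacement mu pi.
have inM i : i \in pdom mu -> mu i = Some (pi (nu i)).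
  by rewrite inE ffunE; case: (mu i) => // i' _; rewrite permKV.
apply: (@exists_witness _ k nu (pdom mu)).
- move=> i j iM jM nuij; apply: injmu => //.
  by rewrite !inM // nuij.
- by apply/subsetP => i; rewrite !inE ffunE; case: (mu i) => //; rewrite eqxx.
- exact: card_edge_sets.
move=> i; rewrite inE => nui.
have iM : i \in pdom mu.
  by apply: contraNT nui; rewrite inE negbK ffunE => /eqP ->.
apply: leq_trans (forall_inP degmu i iM) (subset_leq_card _).
apply/subsetP => j; rewrite [j \in [set _ in _ | _]]inE => /andP[jM].
rewrite /inter_graph !inM // adj_relabel !adjE => /andP[ij nuij].
have sub1' := subsetP (edge_setsS sub1).
have sub2' := subsetP (edge_setsS sub2).
by rewrite inE jM imsetU1 imset_set1 sub1' ?sub2'.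
Qed.

Local Open Scope ring_scope.

(** * Edge probabilities *)

Lemma sum_superset_prod (R : comNzRingType) (T : finType) (S : {set T})
    (r : T -> R) :
  \sum_(A : {set T} | S \subset A)
    \prod_e (if e \in A then r e else 1 - r e) = \prod_(e in S) r e.
Proof.
transitivity (\prod_e (r e + (if e \in S then 0 else 1 - r e))); last first.
  rewrite [RHS]big_mkcond; apply: eq_bigr => e _.
  by case: (e \in S); rewrite ?addr0 // addrC subrK.
rewrite bigA_distr /= big_mkcond; apply: eq_bigr => A _.
case: ifPn => [/subsetP SA|/subsetPn[e eS /negPf eA]]; last first.
  by rewrite (bigD1 e) //= eA eS mul0r.
apply: eq_bigr => e _; case: ifPn => // eA.
by rewrite ifN //; apply: contraNN eA => /SA.
Qed.

(** The union bound. *)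
Lemma ler_sum_exists (R : numDomainType) (I J : finType) (P : pred I)
    (A : I -> pred J) (m : J -> R) :
  (forall j, 0 <= m j) ->
  \sum_(j | [exists i, P i && A i j]) m j
    <= \sum_(i | P i) \sum_(j | A i j) m j.
Proof.
move=> m0; rewrite (exchange_big_dep predT) //= big_mkcond /=.
apply: ler_sum => j _; case: ifPn => [/existsP[i Aij]|_]; last exact: sumr_ge0.
by rewrite (bigD1 i) //= lerDl sumr_ge0.
Qed.

Section Mass.
Variables (R : realType) (n : nat).
Implicit Types (p q s pbar : R) (G H : graph n).

Lemma sbm_mass_ge0 p q (sigma : labels n) G :
  0 <= p <= 1 -> 0 <= q <= 1 -> 0 <= sbm_mass p q sigma G.
Proof.
move=> p01 q01; rewrite mulr_ge0 ?exprn_ge0 ?invr_ge0 //.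
by apply: prodr_ge0 => e _ /=; do 2 case: ifP => _; lra.
Qed.

Lemma sum_sbm_superset p q (E : {set edge n}) :
  \sum_sigma \sum_(G : graph n | E \subset G) sbm_mass p q sigma G =
  2^-1 ^+ n * \sum_(sigma : labels n)
                \prod_(e in E) (if same_label sigma e then p else q).
Proof.
rewrite mulr_sumr; apply: eq_bigr => sigma _.
by rewrite -sum_superset_prod mulr_sumr.
Qed.

Lemma avg_labels (c : R) : 2^-1 ^+ n * (\sum_(sigma : labels n) c) = c.
Proof.
rewrite sumr_const card_ffun card_bool card_ord -[c *+ _]mulr_natl natrX.
by rewrite mulrA -exprMn mulVf ?expr1n ?mul1r.
Qed.

Lemma sum_sbm_mass p q :
  \sum_sigma \sum_(G : graph n) sbm_mass p q sigma G = 1.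
Proof.
have := sum_sbm_superset p q finset.set0.
under eq_bigr => sigma _ do under eq_bigl => G do rewrite sub0set.
by move=> ->; under eq_bigr => sigma _ do rewrite big_set0; exact: avg_labels.
Qed.

(** Given the labels, the edges are independent and each has probability at most
    [pbar]. If some member of [Q] is not a pair, the left side is 0. *)
Lemma sbm_contains_le p q pbar (Q : {set {set 'I_n}}) :
  0 <= p <= pbar -> 0 <= q <= pbar ->
  \sum_sigma \sum_(G : graph n | Q \subset edge_sets G) sbm_mass p q sigma G
    <= pbar ^+ #|Q|.
Proof.
move=> p0 q0; have pbar0 : 0 <= pbar by lra.
have [QE|/subsetPn[e eQ eE]] := boolP (Q \subset edge_sets [set: edge n]);
    last first.
  rewrite big1 ?exprn_ge0 // => sigma _; rewrite big_pred0 // => G.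
  apply: contraNF eE => /subsetP/(_ e eQ).
  exact/subsetP/edge_setsS/subsetT.
pose E := [set e : edge n | val e \in Q].
have QimE : Q = val @: E.
  apply/setP => e; apply/idP/imsetP => [eQ|[x + ->]]; last by rewrite inE.
  by have /imsetP[x _ ex] := subsetP QE e eQ; exists x; rewrite // inE -ex.
have subE G : (Q \subset edge_sets G) = (E \subset G).
  rewrite QimE; apply/idP/idP => [/subsetP sub|]; last exact: imsetS.
  apply/subsetP => e eE.
  by have /imsetP[x xG /val_inj ->] := sub _ (imset_f val eE).
have -> : #|Q| = #|E| by rewrite QimE card_imset //; exact: val_inj.
under eq_bigr => sigma _ do under eq_bigl => G do rewrite subE.
rewrite sum_sbm_superset -[leRHS]avg_labels ler_wpM2l ?exprn_ge0 ?invr_ge0 //.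
apply: ler_sum => sigma _; rewrite -prodr_const; apply: ler_prod => e _.
by case: ifP.
Qed.

Lemma sum_subsample_mass s G : \sum_H subsample_mass s G H = 1.
Proof.
transitivity (\prod_(e : edge n)
    ((if e \in G then s else 0) + (if e \in G then 1 - s else 1))).
  rewrite bigA_distr; apply: eq_bigr => H _; apply: eq_bigr => e _.
  by do 2 case: (e \in _).
by apply: big1 => e _; case: (e \in G); rewrite ?add0r // addrC subrK.
Qed.

Lemma subsample_mass_ge0 s G H : 0 <= s <= 1 -> 0 <= subsample_mass s G H.
Proof.
by move=> s01; apply: prodr_ge0 => e _; do 2 case: ifP => _; lra.
Qed.

Lemma subsample_mass_neq0 s G H : subsample_mass s G H != 0 -> H \subset G.
Proof.
apply: contra_neqT => /subsetPn[e eH /negPf eG].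
by rewrite /subsample_mass (bigD1 e) //= eG eH mul0r.
Qed.

Definition parent (w : outcome n) : graph n :=
  let: (_, G, _, _, _) := w in G.

Lemma sum_csbm_mass_parent p q s (P : pred (graph n)) :
  \sum_(w : outcome n | P (parent w)) csbm_mass p q s w =
  \sum_sigma \sum_(G : graph n | P G) sbm_mass p q sigma G.
Proof.
rewrite big_mkcond /=.
under [RHS]eq_bigr => sigma _ do rewrite big_mkcond /=.
rewrite pair_bigA /=.
transitivity (\sum_(a : labels n * graph n) \sum_(G1 : graph n)
   \sum_(G2 : graph n) \sum_(pi : 'S_n)
     if P a.2 then csbm_mass p q s (a.1, a.2, G1, G2, pi) else 0).
  rewrite !pair_bigA /=; apply: eq_bigr => -[[[[sigma G] G1] G2] pi] _ //.
apply: eq_bigr => -[sigma G] _ /=; case: ifP => PG; last first.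
  by do 3![apply: big1 => ? _].
under eq_bigr => G1 _ do under eq_bigr => G2 _ do
  rewrite sumr_const card_Sn -[_ *+ _]mulr_natr
  divfK ?pnatr_eq0 -?lt0n ?fact_gt0 //.
under eq_bigr => G1 _ do rewrite -mulr_sumr sum_subsample_mass mulr1.
by rewrite -mulr_sumr sum_subsample_mass mulr1.
Qed.

Lemma csbm_mass_ge0 p q s (w : outcome n) :
  0 <= p <= 1 -> 0 <= q <= 1 -> 0 <= s <= 1 -> 0 <= csbm_mass p q s w.
Proof.
case: w => -[[[sigma G] G1] G2] pi p01 q01 s01 /=.
rewrite mulr_ge0 ?invr_ge0 // mulr_ge0 ?subsample_mass_ge0 //.
by rewrite mulr_ge0 ?sbm_mass_ge0 ?subsample_mass_ge0.
Qed.

End Mass.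

(** * The union bound over vertex maps *)

(** The price of one moved vertex: it lies on at most [n] pairs, of which one can
    be charged to it as a fixed pair, and [u ^+ 6] per chosen edge against
    [u ^- k] per vertex is the Chernoff weight. *)
Definition vertex_weight (R : realType) (n k : nat) (u pbar : R) : R :=
  (1 + u ^+ 6 * pbar) * (1 + u ^+ 6 * pbar ^+ 2) ^+ n / u ^+ k.

Section Witnesses.
Variables (R : realType) (n : nat).
Implicit Types (nu : 'I_n -> 'I_n).

Lemma card_touching (D : {set 'I_n}) : (#|touching D| <= #|D| * n)%N.
Proof.
have sub : touching D \subset
    (fun ij : 'I_n * 'I_n => [set ij.1; ij.2]) @: setX D [set: 'I_n].
  apply/subsetP => e; rewrite inE => /andP[/cards2P[i [j [_ ->]]]].
  case/set0Pn => x; rewrite in_setI !inE => /andP[/orP[/eqP->|/eqP->] xD].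
    by apply/imsetP; exists (i, j); rewrite ?inE ?xD.
  by apply/imsetP; exists (j, i); rewrite ?inE ?xD //= setUC.
apply: leq_trans (subset_leq_card sub) _.
apply: leq_trans (leq_imset_card _ _) _.
by rewrite cardsX cardsT card_ord.
Qed.

(** A fixed pair that contains a moved [i] also contains [nu i], hence is
    [{i, nu i}]. *)
Lemma card_fixed_touching nu :
  (#|[set e in touching (moved nu) | nu @: e == e]| <= #|moved nu|)%N.
Proof.
apply: leq_trans (leq_imset_card (fun i => [set i; nu i]) _).
apply/subset_leq_card/subsetP => e; rewrite !inE -andbA => /and3P[].
case/cards2P => i [j [ij ->]] /set0Pn[x].
rewrite in_setI !inE => /andP[xij nux] /eqP nue.
have : nu x \in [set i; j] by rewrite -nue imset_f // !inE.
rewrite !inE => nuxij; apply/imsetP; exists x; first by rewrite inE.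
case/orP: xij nux nuxij => /eqP ->; first by move=> /negPf -> /= /eqP ->.
by move=> /negPf ->; rewrite orbF => /eqP ->; rewrite setUC.
Qed.

(** As [6 |S| >= k |D|], each term may be multiplied by [u ^ (6 |S| - k |D|)],
    which is at least 1; the sum over all [S] contained in [touching D] then
    factors over pairs. *)
Lemma sum_witness_le (k : nat) (u pbar : R) nu :
  1 <= u -> 0 <= pbar ->
  \sum_(S | witness k nu S)
     pbar ^+ #|S :|: (fun e : {set 'I_n} => nu @: e) @: S|
  <= vertex_weight n k u pbar ^+ #|moved nu|.
Proof.
move=> u1 pbar0; set D := moved nu; have u0 : 0 < u by lra.
pose w (e : {set 'I_n}) := u ^+ 6 * pbar ^+ #|[set e; nu @: e]|.
have w0 e : 0 <= w e by rewrite mulr_ge0 ?exprn_ge0 // ltW.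
rewrite /vertex_weight exprMn exprVn -exprM -[leRHS]mulrC.
apply: (@le_trans _ _ ((u ^+ (k * #|D|))^-1 *
    \sum_(S : {set {set 'I_n}} | S \subset touching D) \prod_(e in S) w e)).
  rewrite mulr_sumr [leLHS]big_mkcond [leRHS]big_mkcond /=.
  apply: ler_sum => S _; case: ifP => [/and3P[-> leS /eqP ->]|_]; last first.
    case: ifP => // _.
    by rewrite mulr_ge0 ?invr_ge0 ?exprn_ge0 ?prodr_ge0 // ltW.
  rewrite big_split /= prodr_const -exprM expr_sum mulrA ler_peMl //.
    by apply: prodr_ge0 => e _; apply: exprn_ge0.
  by rewrite mulrC ler_pdivlMr ?exprn_gt0 // mul1r ler_weXn2l.
apply: ler_wpM2l; first by rewrite invr_ge0 exprn_ge0 // ltW.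
have -> : \sum_(S : {set {set 'I_n}} | S \subset touching D) \prod_(e in S) w e
    = \prod_(e in touching D) (1 + w e).
  transitivity (\prod_e ((if e \in touching D then w e else 0) + 1)).
    rewrite bigA_distr big_mkcond; apply: eq_bigr => S _ /=.
    case: ifPn => [/subsetP sub|/subsetPn[e eS /negPf eD]]; last first.
      by rewrite (bigD1 e) //= eS eD mul0r.
    rewrite big_mkcond; apply: eq_bigr => e _.
    by case: ifP => // /sub ->.
  rewrite [RHS]big_mkcond; apply: eq_bigr => e _.
  by case: ifP; rewrite ?add0r // addrC.
rewrite (bigID (fun e : {set 'I_n} => nu @: e == e)) /= exprMn -exprM.
have ge1 i : 1 <= 1 + u ^+ 6 * pbar ^+ i.
  by rewrite lerDl mulr_ge0 ?exprn_ge0 // ltW.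
apply: ler_pM.
- by apply: prodr_ge0 => e _; rewrite addr_ge0.
- by apply: prodr_ge0 => e _; rewrite addr_ge0.
- rewrite (eq_bigr (fun=> 1 + u ^+ 6 * pbar)); last first.
    by move=> e /andP[_ /eqP fe]; rewrite /w fe setUid cards1.
  rewrite (eq_bigl (fun e => e \in [set e in touching D | nu @: e == e])); last first.
    by move=> e; rewrite inE.
  by rewrite prodr_const ler_weXn2l ?card_fixed_touching // (ge1 1%N).
- apply: (@le_trans _ _ (\prod_(e in touching D) (1 + u ^+ 6 * pbar ^+ 2))).
    rewrite [leRHS](bigID (fun e : {set 'I_n} => nu @: e == e)) /=.
    rewrite -[leLHS]mul1r ler_pM ?prodr_ge0 //.
    + by move=> e _; rewrite addr_ge0.
    + by elim/big_ind: _ => [//|x y x1 y1|e _]; [exact: mulr_ege1 | exact: ge1].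
    + rewrite le_eqVlt; apply/orP; left; apply/eqP/eq_bigr => e /andP[_ ne].
      by rewrite /w cards2 eq_sym ne.
  by rewrite prodr_const ler_weXn2l ?ge1 // mulnC card_touching.
Qed.

(** Choose [nu i] independently for each [i]: weight 1 for [i] itself and [x] for
    each of the [n - 1] other values. *)
Lemma sum_moved (x : R) :
  \sum_(nu : {ffun 'I_n -> 'I_n}) x ^+ #|moved nu| = (1 + n.-1%:R * x) ^+ n.
Proof.
transitivity (\prod_(i < n) \sum_(j < n) (if j == i then 1 else x)).
  rewrite bigA_distr_bigA; apply: eq_bigr => nu _.
  rewrite -prodr_const big_mkcond; apply: eq_bigr => i _.
  by rewrite inE; case: eqP.
rewrite (eq_bigr (fun=> 1 + n.-1%:R * x)) ?prodr_const ?card_ord // => i _.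
rewrite (bigD1 i) //= eqxx; congr (_ + _).
rewrite (eq_bigr (fun=> x)) => [|j /negPf -> //].
by rewrite sumr_const cardC1 card_ord mulr_natl.
Qed.

Lemma sum_moved_neq0_le (x : R) : 0 <= x ->
  \sum_(nu : {ffun 'I_n -> 'I_n} | moved nu != set0) x ^+ #|moved nu|
    <= expR (n%:R ^+ 2 * x) - 1.
Proof.
move=> x0.
have idE (nu : {ffun 'I_n -> 'I_n}) :
    (moved nu != set0) = (nu != [ffun i => i]).
  congr negb; apply/eqP/eqP => [nu0|->]; last first.
    by apply/setP => i; rewrite !inE ffunE eqxx.
  apply/ffunP => i; rewrite ffunE; apply/eqP.
  by move/setP/(_ i): nu0; rewrite !inE => /negbFE.
rewrite lerBrDr addrC.
have := sum_moved x; rewrite (bigD1 [ffun i => i]) //=.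
rewrite (_ : moved _ = set0) ?cards0 ?expr0; last first.
  by apply/eqP/negbFE; rewrite idE eqxx.
under eq_bigl => nu do rewrite -idE.
move=> ->; rewrite expr2 -mulrA expRM_natl lerXn2r ?nnegrE ?expR_ge0 //.
  by rewrite addr_ge0 ?mulr_ge0.
apply: le_trans (expR_ge1Dx _) _; rewrite ler_expR ler_wpM2r // ler_nat.
exact: leq_pred.
Qed.

End Witnesses.

(** The failure event is traded for one about the parent graph alone, so that the
    subsampled graphs and the permutation can be summed out before the union
    bound. This is licit because [G1] and [G2] lie inside [G] wherever the mass
    does not vanish. *)
Lemma csbm_prob_core_matching_bounds (R : realType) (n k : nat)
    (p q s pbar u : R) (muhat : outcome n -> pfun n) :
  (forall w, maximal_core_matching k (obs1 w) (obs2 w) (muhat w)) ->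
  0 <= p <= pbar -> 0 <= q <= pbar -> pbar <= 1 -> 0 <= s <= 1 -> 1 <= u ->
  2 - expR (n%:R ^+ 2 * vertex_weight n k u pbar)
    <= csbm_prob p q s (fun w : outcome n =>
         muhat w == perm_restrict (latent_perm w) (true_core k w)) <= 1.
Proof.
move=> hmu p0 q0 pbar1 s01 u1.
set x := vertex_weight _ _ _ _; set P := csbm_prob _ _ _ _.
pose E (w : outcome n) :=
  muhat w == perm_restrict (latent_perm w) (true_core k w).

have p01 : 0 <= p <= 1 by lra.
have q01 : 0 <= q <= 1 by lra.
have pbar0 : 0 <= pbar by lra.
have mass0 w := csbm_mass_ge0 w p01 q01 s01.
have x0 : 0 <= x.
  have u6 i : 0 <= 1 + u ^+ 6 * pbar ^+ i.
    by rewrite addr_ge0 ?mulr_ge0 ?exprn_ge0 //; lra.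
  rewrite mulr_ge0 ?invr_ge0 ?exprn_ge0 ?mulr_ge0 ?exprn_ge0 //.
    exact: (u6 1%N).
  by lra.
have total : P + \sum_(w | ~~ E w) csbm_mass p q s w = 1.
  rewrite -(sum_sbm_mass n p q) -(sum_csbm_mass_parent p q s predT).
  by rewrite [RHS](bigID E) /=.
have fail : \sum_(w | ~~ E w) csbm_mass p q s w <= expR (n%:R ^+ 2 * x) - 1.
  pose phi (nu : {ffun 'I_n -> 'I_n}) (e : {set 'I_n}) := nu @: e.
  pose good (i : {ffun 'I_n -> 'I_n} * {set {set 'I_n}}) :=
    (moved i.1 != set0) && witness k i.1 i.2.
  pose inG i G := i.2 :|: phi i.1 @: i.2 \subset edge_sets G.
  apply: (@le_trans _ _ (\sum_(w : outcome n |
      [exists i, good i && inG i (parent w)]) csbm_mass p q s w)).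
    rewrite [leLHS]big_mkcond [leRHS]big_mkcond; apply: ler_sum => w _.
    case: ifPn => [Ew|_]; last by case: ifP.
    have [->|nz] := eqVneq (csbm_mass p q s w) 0; first by case: ifP.
    suff -> : [exists i, good i && inG i (parent w)] by [].
    have [sub1 sub2] : obs1 w \subset parent w /\ w.1.2 \subset parent w.
      move: nz; case: (w) => -[[[sigma G] G1] G2] pi /=.
      move=> nz; split; apply: (@subsample_mass_neq0 _ _ s).
        by apply: contra_neq nz => ->; rewrite mulr0 !mul0r.
      by apply: contra_neq nz => ->; rewrite mulr0 mul0r.
    have obs2E : obs2 w = relabel (latent_perm w) w.1.2.
      by case: (w) => -[[[sigma G] G1] G2] pi.
    have max_w := hmu w; have := max_w.1; rewrite obs2E => core_w.
    have [S witS subS] := core_matching_witness sub1 sub2 core_w.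
    apply/existsP; exists (displacement (muhat w) (latent_perm w), S).
    rewrite /good /inG witS subS !andbT; apply: contraNneq Ew => moved0.
    apply/eqP; apply: maximal_core_matching_eq max_w _ => i.
    by move/setP/(_ i): moved0; rewrite !inE => /negbFE/eqP.
  rewrite (sum_csbm_mass_parent p q s
    (fun G => [exists i, good i && inG i G])).
  apply: (@le_trans _ _ (\sum_(i | good i) \sum_sigma
      \sum_(G | inG i G) sbm_mass p q sigma G)).
    rewrite [leRHS]exchange_big /=; apply: ler_sum => sigma _.
    by apply: ler_sum_exists => G; apply: sbm_mass_ge0.
  apply: le_trans (sum_moved_neq0_le n x0).
  apply: (@le_trans _ _
      (\sum_(nu : {ffun 'I_n -> 'I_n} | moved nu != finset.set0)
        \sum_(S | witness k nu S) pbar ^+ #|S :|: phi nu @: S|)).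
    rewrite [leRHS]pair_big_dep /=; apply: ler_sum => i _.
    exact: sbm_contains_le.
  by apply: ler_sum => nu _; apply: (sum_witness_le k nu u1 pbar0).
have fail0 : 0 <= \sum_(w | ~~ E w) csbm_mass p q s w by apply: sumr_ge0.
by lra.
Qed.

Local Open Scope classical_set_scope.

(** * Asymptotics *)

Lemma mul_expRN_le (R : realType) (c x : R) : 0 < c ->
  x * expR (- (c * x)) <= c^-1.
Proof.
move=> c0; rewrite expRN ler_pdivrMr ?expR_gt0 //.
rewrite mulrC ler_pdivlMr // mulrC.
by apply: le_trans (expR_ge1Dx _); rewrite lerDr.
Qed.

Lemma cvg_expRN_ln (R : realType) (c : R) : 0 < c ->
  expR (- (c * ln n%:R)) @[n --> \oo] --> (0 : R).
Proof.
move=> c0.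
apply: (cvg_comp (fun n : nat => c * ln (n%:R : R)) (fun x => expR (- x)));
  last exact: cvgr_expR.
apply/cvgryPge => A; near=> n.
rewrite mulrC -ler_pdivrMr // -[leLHS]expRK ler_ln ?posrE ?expR_gt0 //.
  by near: n; exact: nbhs_infty_ger.
by rewrite ltr0n; near: n; exact: nbhs_infty_gt.
Unshelve. all: by end_near. Qed.

(** With [u = n ^ (4/25)], [u ^+ 6 * pbar] is [K * L * n ^ (- 1/25)], the exponent
    [n * u ^+ 6 * pbar ^+ 2] is [(K * L * n ^ (- 1/50)) ^ 2], and
    [n ^ 2 / u ^ 13] is [n ^ (- 2/25)]. The constants 25 and [2500 = 50 ^ 2] come
    from [mul_expRN_le]. *)
Lemma vertex_weight_le (R : realType) (n : nat) (K : R) :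
  let L := ln n%:R in
  (0 < n)%N -> 0 <= K ->
  n%:R ^+ 2 * vertex_weight n 13 (expR (4 / 25 * L)) (K * L / n%:R)
    <= (1 + 25 * K) * expR (2500 * K ^+ 2) * expR (- (2 / 25 * L)).
Proof.
move=> L n0 K0; set u := expR (4 / 25 * L); set pbar := _ / n%:R.
have L0 : 0 <= L by rewrite ln_ge0 // ler1n.
have nE : n%:R = expR L by rewrite lnK // posrE ltr0n.
have pbarE : pbar = K * (L * expR (- L)) by rewrite /pbar nE expRN mulrA.
have pbar0 : 0 <= pbar by rewrite pbarE !mulr_ge0 ?expR_ge0.
have uX k : u ^+ k = expR (k%:R * (4 / 25 * L)) by rewrite expRM_natl.
have fixed_le : u ^+ 6 * pbar <= 25 * K.
  have -> : u ^+ 6 * pbar = K * (L * expR (- (25^-1 * L))).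
    have -> : - (25^-1 * L) = 6%:R * (4 / 25 * L) - L by lra.
    by rewrite expRD -uX pbarE; ring.
  rewrite mulrC ler_wpM2r //.
  by apply: le_trans (mul_expRN_le _ _) _; rewrite ?invr_gt0 ?invrK.
have moved_le : (1 + u ^+ 6 * pbar ^+ 2) ^+ n <= expR (2500 * K ^+ 2).
  apply: (@le_trans _ _ (expR (u ^+ 6 * pbar ^+ 2) ^+ n)).
    rewrite lerXn2r ?nnegrE ?expR_ge0 ?expR_ge1Dx //.
    by rewrite addr_ge0 ?mulr_ge0 ?exprn_ge0 ?expR_ge0.
  rewrite -expRM_natl ler_expR.
  have -> : n%:R * (u ^+ 6 * pbar ^+ 2) =
      (L * expR (- (50^-1 * L))) ^+ 2 * K ^+ 2.
    have e2 : expR (- (50^-1 * L)) ^+ 2 = expR L * u ^+ 6 * expR (- L) ^+ 2.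
      by rewrite -!expRM_natl -!expRD; congr expR; lra.
    by rewrite pbarE !exprMn e2 nE; ring.
  rewrite ler_wpM2r ?sqr_ge0 //.
  have -> : 2500 = 50 ^+ 2 :> R by lra.
  rewrite lerXn2r ?nnegrE ?mulr_ge0 ?expR_ge0 //.
  by apply: le_trans (mul_expRN_le _ _) _; rewrite ?invr_gt0 ?invrK.
have -> : expR (- (2 / 25 * L)) = n%:R ^+ 2 / u ^+ 13.
  by rewrite nE uX -expRN -expRM_natl -expRD; congr expR; lra.
have -> : n%:R ^+ 2 * vertex_weight n 13 u pbar =
    (1 + u ^+ 6 * pbar) * (1 + u ^+ 6 * pbar ^+ 2) ^+ n
      * (n%:R ^+ 2 / u ^+ 13) by rewrite /vertex_weight; ring.
rewrite ler_wpM2r ?mulr_ge0 ?invr_ge0 ?exprn_ge0 ?expR_ge0 //.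
rewrite ler_pM ?exprn_ge0 ?addr_ge0 ?mulr_ge0 ?exprn_ge0 ?expR_ge0 //.
by rewrite lerD2l.
Qed.

Theorem lemma4p8 (R : realType) (alpha beta s : R)
  (halpha : 0 < alpha) (hbeta : 0 < beta) (hs : 0 <= s <= 1)
  (muhat : forall n : nat, outcome n -> pfun n)
  (hmuhat : forall (n : nat) (w : outcome n),
     maximal_core_matching 13 (obs1 w) (obs2 w) (muhat n w)) :
  (fun n : nat =>
     csbm_prob (alpha * ln n%:R / n%:R) (beta * ln n%:R / n%:R) s
       (fun w : outcome n =>
          muhat n w == perm_restrict (latent_perm w) (true_core 13 w)))
    @ \oo --> (1 : R).
Proof.
pose K := alpha + beta; have K0 : 0 < K by rewrite addr_gt0.
pose C := (1 + 25 * K) * expR (2500 * K ^+ 2).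
pose eps (n : nat) : R := expR (- (2 / 25 * ln n%:R)).
have eps0 : eps @ \oo --> (0 : R) by apply: cvg_expRN_ln; rewrite divr_gt0.
apply: (@squeeze_cvgr _ _ _ _ (fun n => 2 - expR (C * eps n)) (fun=> 1)).
- near=> n.
  have n0 : (0 < n)%N by near: n; exact: nbhs_infty_gt.
  set L := ln n%:R; set p := _ / _; set q := _ / _.
  have L0 : 0 <= L by rewrite ln_ge0 // ler1n.
  have Ln0 : 0 <= L / n%:R by rewrite divr_ge0.
  have weight := vertex_weight_le n0 (ltW K0).
  (* Only for large n are the edge probabilities at most 1. *)
  have pbar1 : K * L / n%:R <= 1.
    have epsK : eps n <= (2 * K)^-1.
      by near: n; apply: (cvgr_le 0) => //; rewrite invr_gt0 mulr_gt0.
    have -> : K * L / n%:R = K * (L * expR (- (23 / 25 * L))) * eps n.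
      have nE : expR L = n%:R by rewrite lnK // posrE ltr0n.
      rewrite -nE -expRN -!mulrA -expRD; congr (_ * (_ * expR _)).
      by rewrite -/L; lra.
    have c0 : 0 < 23 / 25 :> R by lra.
    have /(ler_wpM2l (ltW K0)) := mul_expRN_le L c0.
    have eps_ge0 : 0 <= eps n := expR_ge0 _.
    have : 2 * K * eps n <= 1 by rewrite mulrC -ler_pdivlMr ?mul1r ?mulr_gt0.
    move=> epsK1 /(ler_wpM2r eps_ge0) LK; apply: le_trans LK _.
    by nra.
  have u1 : 1 <= expR (4 / 25 * L) by rewrite -expR0 ler_expR mulr_ge0.
  have p0 : 0 <= p <= K * L / n%:R.
    by rewrite /p -!mulrA (mulr_ge0 (ltW halpha) Ln0) ler_wpM2r // lerDl ltW.
  have q0 : 0 <= q <= K * L / n%:R.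
    by rewrite /q -!mulrA (mulr_ge0 (ltW hbeta) Ln0) ler_wpM2r // lerDr ltW.
  have /andP[lo ->] :=
    csbm_prob_core_matching_bounds (@hmuhat n) p0 q0 pbar1 hs u1.
  rewrite andbT; apply: le_trans lo.
  by rewrite lerB // ler_expR.
- suff : 2 - expR (C * eps n) @[n --> \oo] --> 2 - expR (C * 0).
    by rewrite mulr0 expR0 addrK.
  apply: cvgB; first exact: cvg_cst.
  apply: (cvg_comp (fun n => C * eps n) expR); last exact: continuous_expR.
  exact: cvgM (cvg_cst _) eps0.
- exact: cvg_cst.
Unshelve. all: by end_near. Qed.
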